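(* Let $\{w^k\}_{k\ge 0}$ and $\{\tilde w^k\}_{k\ge 0}$, $w^k=(x^k;y^k)$, $\tilde w^k=(\tilde x^k;\tilde y^k)$, be the sequences generated by the adaptive dual primal hybrid gradient algorithm (described in the context), and suppose that the relaxed condition $$\frac1s\|A(x^k-\tilde x^k)\|^2\le \nu\, r_k\|x^k-\tilde x^k\|^2,\qquad \nu\in(0,1),$$ holds for all $k\ge 0$. Then the sequence $\{w^k\}$ converges to some $w^\infty\in\Omega^*$.
   Context: Problem. Consider $\min_{x\in\mathcal X}\max_{y\in\mathcal Y}\Phi(x,y):=\theta_1(x)-y^TAx-\theta_2(y)$, where $\theta_1:\mathbb R^n\to\mathbb R$ and $\theta_2:\mathbb R^m\to\mathbb R$ are (finite-valued) convex, not necessarily smooth, functions, $\mathcal X\subseteq\mathbb R^n$ and $\mathcal Y\subseteq\mathbb R^m$ are closed convex sets, and $A\in\mathbb R^{m\times n}$ is a nonzero matrix. The solution (saddle point) set is assumed nonempty. Put $\Omega=\mathcal X\times\mathcal Y$, $w=(x;y)$, $\theta(w)=\theta_1(x)+\theta_2(y)$, $F(w)=(-A^Ty;\,Ax)$. $\Omega^*$ denotes the set of $w^*\in\Omega$ with $\theta(w)-\theta(w^* )+(w-w^* )^TF(w^* )\ge 0$ for all $w\in\Omega$; equivalently, the set of saddle points of $\Phi$ on $\mathcal X\times\mathcal Y$. Notation. $\rho(\cdot)$ is the largest eigenvalue of a symmetric positive semidefinite matrix; $\rho_{\mathrm{average}}(A^TA)=\frac1n\mathrm{Trace}(A^TA)$,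 $\rho_{\mathrm{average}}(AA^T)=\frac1m\mathrm{Trace}(AA^T)$. For symmetric positive definite $H$, $\|w\|_H^2=w^THw$. Parameters. $s=\tau\rho_{\mathrm{average}}(AA^T)$ with $\tau\in[1/5,5]$; $r_0=\frac{3}{2s}\rho_{\mathrm{average}}(A^TA)$; $r_a=\frac1s\kappa\rho_{\mathrm{average}}(A^TA)$ with $\kappa\in[1/10,10]$; threshold $r_{\min}=\sqrt{\rho_{\mathrm{average}}(A^TA)/\rho(A^TA)}\;r_a$; $\gamma\in(0,2)$, $\nu\in(0,1)$, $\mu\in(0,\nu)$, $\theta>1/\nu$ (default values $\gamma=1$, $\theta=1.2$, $\mu=0.5$, $\nu=0.9$; this scalar $\theta$ is unrelated to the function $\theta(w)$). Matrices. For $r_k>0$, $$Q_k^{DP}=\begin{pmatrix} r_kI_n&0\\-A&sI_m\end{pmatrix},\quad H^{DP}=\begin{pmatrix} r_aI_n&0\\0&sI_m\end{pmatrix},\quad M_k^{DP}=\begin{pmatrix}\frac{r_k}{r_a}I_n&0\\-\frac1sA&I_m\end{pmatrix}.$$ Adaptive dual primal hybrid gradient algorithm. Start from $w^0=(x^0;y^0)\in\mathbb R^n\times\mathbb R^m$. For $k=0,1,2,\dots$: (1) $\tilde y^k\in\arg\max\{\Phi(x^k,y)-\frac s2\|y-y^k\|^2: y\in\mathcal Y\}$. (2) $\tilde x^k\in\arg\min\{\Phi(x,\tilde y^k)+\frac{r_k}2\|x-x^k\|^2: x\in\mathcal X\}$; compute $t=\big(\frac1s\|A(x^k-\tilde x^k)\|^2\big)/\big(r_k\|x^k-\tilde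 x^k\|^2\big)$ (with $t=0$ if $\tilde x^k=x^k$). While $t>\nu$: replace $r_k$ by $r_k\cdot t\cdot\theta$, recompute $\tilde x^k$ with the new $r_k$, and recompute $t$. From now on $r_k$ denotes the final value in iteration $k$. (3) $w^{k+1}=w^k-\gamma\alpha_k^*M_k^{DP}(w^k-\tilde w^k)$ with $\alpha_k^*=\dfrac{(w^k-\tilde w^k)^TQ_k^{DP}(w^k-\tilde w^k)}{\|M_k^{DP}(w^k-\tilde w^k)\|_{H^{DP}}^2}$. (4) If $t\le\mu$ and $r_k>r_{\min}$, set $r_{k+1}=\max\{\frac23r_k,\,r_{\min}\}$; otherwise set $r_{k+1}=r_k$ (this is the initial value of the parameter for iteration $k+1$). The stopping criterion is ignored, so the sequences are infinite, and it is assumed throughout that $w^k\ne\tilde w^k$ for all $k$ (otherwise $w^k$ is already a solution). *)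

(* Defs.v *)
From HB Require Import structures.
From mathcomp Require Import all_boot all_order all_algebra.
From mathcomp Require Import all_classical all_reals all_analysis.

Set Implicit Arguments.
Unset Strict Implicit.
Unset Printing Implicit Defensive.

Import Order.TTheory GRing.Theory Num.Theory.
Import numFieldNormedType.Exports.

Local Open Scope classical_set_scope.
Local Open Scope ring_scope.

Section Generic.
Context {R : realType}.

Definition dotv n (u v : 'cV[R]_n) : R := (u^T *m v) 0 0.

(* The library norm `|u| on 'cV[R]_n is the sup norm; the Euclidean norm and
   the H-weighted norm only ever occur squared here. *)
Definition sqnorm n (u : 'cV[R]_n) : R := dotv u u.
Definition sqnormH n (H : 'M[R]_n) (u : 'cV[R]_n) : R := dotv u (H *m u).

Definition argmin (T : Type) (D : set T) (f : T -> R) : set T :=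
  [set x | D x /\ forall y, D y -> f x <= f y].
Definition argmax (T : Type) (D : set T) (f : T -> R) : set T :=
  [set x | D x /\ forall y, D y -> f y <= f x].

(* The spectrum is finite, and for a symmetric B of positive size nonempty, so
   that this supremum is then a maximum. *)
Definition rho n (B : 'M[R]_n) : R := sup [set a : R | eigenvalue B a].

Definition rho_average n (B : 'M[R]_n) : R := \tr B / n%:R.

End Generic.

Section Problem.
Context {R : realType} {n m : nat}.
Variables (A : 'M[R]_(m, n)) (theta1 : 'cV[R]_n -> R) (theta2 : 'cV[R]_m -> R).
Variables (X : set 'cV[R]_n) (Y : set 'cV[R]_m).

Definition Phi (x : 'cV[R]_n) (y : 'cV[R]_m) : R :=
  theta1 x - dotv y (A *m x) - theta2 y.

(* A point w = (x; y) is the stacked column vector col_mx x y; its components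
   are usubmx w and dsubmx w. *)
Definition Omega : set 'cV[R]_(n + m) := [set w | X (usubmx w) /\ Y (dsubmx w)].

Definition thetaw (w : 'cV[R]_(n + m)) : R :=
  theta1 (usubmx w) + theta2 (dsubmx w).

Definition F (w : 'cV[R]_(n + m)) : 'cV[R]_(n + m) :=
  col_mx (- (A^T *m dsubmx w)) (A *m usubmx w).

Definition Omega_star : set 'cV[R]_(n + m) :=
  [set ws | Omega ws /\ forall w, Omega w ->
     0 <= thetaw w - thetaw ws + dotv (w - ws) (F ws)].

End Problem.

Section Algorithm.
Context {R : realType} {n m : nat}.
Variables (A : 'M[R]_(m, n)) (theta1 : 'cV[R]_n -> R) (theta2 : 'cV[R]_m -> R).
Variables (X : set 'cV[R]_n) (Y : set 'cV[R]_m).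

Definition s_of (tau : R) : R := tau * rho_average (A *m A^T).
Definition r0_of (tau : R) : R :=
  3 / (2 * s_of tau) * rho_average (A^T *m A).
Definition ra_of (tau kappa : R) : R :=
  1 / s_of tau * kappa * rho_average (A^T *m A).
Definition rmin_of (tau kappa : R) : R :=
  Num.sqrt (rho_average (A^T *m A) / rho (A^T *m A)) * ra_of tau kappa.

Definition Q_DP (s r : R) : 'M[R]_(n + m) :=
  block_mx r%:M 0 (- A) s%:M.
Definition H_DP (s ra : R) : 'M[R]_(n + m) :=
  block_mx ra%:M 0 0 s%:M.
Definition M_DP (s ra r : R) : 'M[R]_(n + m) :=
  block_mx (r / ra)%:M 0 (- (1 / s *: A)) 1%:M.

Definition ratio (s r : R) (x xt : 'cV[R]_n) : R :=
  if xt == x then 0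
  else (1 / s * sqnorm (A *m (x - xt))) / (r * sqnorm (x - xt)).

Definition ytilde_step (s : R) (x : 'cV[R]_n) (y : 'cV[R]_m) : set 'cV[R]_m :=
  argmax Y (fun y' => Phi A theta1 theta2 x y' - s / 2 * sqnorm (y' - y)).

Definition xtilde_step (r : R) (x : 'cV[R]_n) (yt : 'cV[R]_m) : set 'cV[R]_n :=
  argmin X (fun x' => Phi A theta1 theta2 x' yt + r / 2 * sqnorm (x' - x)).

(* adjust s nu theta x yt r r' xt: the inner while loop, entered with parameter
   r, terminates after finitely many passes with final parameter r' and
   corresponding subproblem solution xt. *)
Inductive adjust (s nu theta : R) (x : 'cV[R]_n) (yt : 'cV[R]_m) :
    R -> R -> 'cV[R]_n -> Prop :=
| adjust_stop r xt :
    xtilde_step r x yt xt -> ratio s r x xt <= nu ->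
    adjust s nu theta x yt r r xt
| adjust_step r xt r' xt' :
    xtilde_step r x yt xt -> nu < ratio s r x xt ->
    adjust s nu theta x yt (r * ratio s r x xt * theta) r' xt' ->
    adjust s nu theta x yt r r' xt'.

Definition alpha_star (s ra r : R) (w wt : 'cV[R]_(n + m)) : R :=
  dotv (w - wt) (Q_DP s r *m (w - wt)) /
  sqnormH (H_DP s ra) (M_DP s ra r *m (w - wt)).

(* rini k is the parameter at the start of iteration k, and r k its final
   value, after the while loop. *)
Record generated_by_adaptive_dual_PDHG (tau kappa gamma nu mu theta : R)
    (w wt : nat -> 'cV[R]_(n + m)) (rini r : nat -> R) : Prop := {
  gen_init : rini 0%N = r0_of tau ;
  gen_ytilde : forall k,
    ytilde_step (s_of tau) (usubmx (w k)) (dsubmx (w k)) (dsubmx (wt k)) ;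
  gen_xtilde : forall k,
    adjust (s_of tau) nu theta (usubmx (w k)) (dsubmx (wt k))
      (rini k) (r k) (usubmx (wt k)) ;
  gen_update : forall k,
    let s := s_of tau in
    let ra := ra_of tau kappa in
    w k.+1 = w k - (gamma * alpha_star s ra (r k) (w k) (wt k)) *:
                     (M_DP s ra (r k) *m (w k - wt k)) ;
  gen_relax : forall k,
    let t := ratio (s_of tau) (r k) (usubmx (w k)) (usubmx (wt k)) in
    let rmin := rmin_of tau kappa in
    rini k.+1 = if (t <= mu) && (rmin < r k)
                then Num.max (2 / 3 * r k) rmin else r k
}.

End Algorithm.

(* Main.v *)
Require Import Defs.
From HB Require Import structures.
From mathcomp Require Import all_boot all_order all_algebra.
From mathcomp Require Import all_classical all_reals all_analysis.
From mathcomp Require Import ring lra.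

Import Order.TTheory GRing.Theory Num.Theory.
Import numFieldNormedType.Exports.

Local Open Scope classical_set_scope.
Local Open Scope ring_scope.

(** The reason for convergence is that the iterates are Fejer monotone with
    respect to the solution set, in the norm of the matrix [H_DP], which does not
    depend on the iteration although the parameter [r k] does.

    Write [d = w k - wt k].  The optimality conditions of the two proximal steps
    add up to the variational inequality of the problem at the predictor [wt k],
    perturbed by [Q_DP *m d] ([prediction_variational_ineq]).  Tested with a
    solution [p], it gives [dotv (w k - p) (Q_DP *m d) >= dotv d (Q_DP *m d)],
    because [F] is skew ([dotv_Q_DP_solution]).  Since [Q_DP = H_DP *m M_DP], the
    correction moves along a direction which makes an acute angle with
    [w k - p] in the [H_DP] scalar product, and the step length [gamma * alpha]
    decreases [|w k - p|_H^2] by a multiple of [dotv d (Q_DP *m d)]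
    ([relaxed_step_decrease]).  The relaxed condition makes this quadratic form
    coercive ([Q_DP_coercive]) and comparable with [|M_DP *m d|_H^2]
    ([sqnormH_M_DP_le]), so that the decrease is at least [c |d|^2].

    The constant [c] does not depend on [k] only if the [r k] stay between two
    positive bounds ([stepsize_bounds]).  From above, the loop cannot produce a
    value larger than [theta * rho (A^T *m A) / s].  From below, the relaxation
    rule stops at [rmin], which is positive because [rho (A^T *m A)] is: this
    supremum of eigenvalues is the maximum of the Rayleigh quotient
    ([sqnorm_mulmx_le_rho]).

    The decrease implies that [d] tends to [0] and that [w] is bounded.  Along a
    subsequence on which [w] converges, the perturbation vanishes and the
    variational inequality passes to the limit ([limit_Omega_star]), because
    finite convex functions on a finite dimensional space are continuous
    ([convex_function_continuous]).  Cluster points are thus solutions, and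
    Fejer monotonicity towards one of them gives convergence of the whole
    sequence ([fejer_cvg]). *)

Set Implicit Arguments.
Unset Strict Implicit.
Unset Printing Implicit Defensive.

(** * Scalar products *)

Section ScalarProduct.
Context {R : realType}.

Lemma dotvE n (u v : 'cV[R]_n) : dotv u v = \sum_i u i 0 * v i 0.
Proof. by rewrite /dotv mxE; apply: eq_bigr => i _; rewrite mxE. Qed.

Lemma dotvC n (u v : 'cV[R]_n) : dotv u v = dotv v u.
Proof. by rewrite !dotvE; apply: eq_bigr => i _; rewrite mulrC. Qed.

Lemma dotvDr n (u v w : 'cV[R]_n) : dotv u (v + w) = dotv u v + dotv u w.
Proof. by rewrite /dotv mulmxDr mxE. Qed.

Lemma dotvNr n (u v : 'cV[R]_n) : dotv u (- v) = - dotv u v.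
Proof. by rewrite /dotv mulmxN mxE. Qed.

Lemma dotvZr n (u v : 'cV[R]_n) (a : R) : dotv u (a *: v) = a * dotv u v.
Proof. by rewrite /dotv -scalemxAr mxE. Qed.

Lemma dotvDl n (u v w : 'cV[R]_n) : dotv (u + v) w = dotv u w + dotv v w.
Proof. by rewrite dotvC dotvDr dotvC [dotv w v]dotvC. Qed.

Lemma dotvNl n (u v : 'cV[R]_n) : dotv (- u) v = - dotv u v.
Proof. by rewrite dotvC dotvNr dotvC. Qed.

Lemma dotvZl n (u v : 'cV[R]_n) (a : R) : dotv (a *: u) v = a * dotv u v.
Proof. by rewrite dotvC dotvZr dotvC. Qed.

Lemma dotv0 n (u : 'cV[R]_n) : dotv u 0 = 0.
Proof. by rewrite /dotv mulmx0 mxE. Qed.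

Definition dotv_lin := (dotvDl, dotvDr, dotvNl, dotvNr, dotvZl, dotvZr).

Lemma dotv_trmul n m (A : 'M[R]_(m, n)) (x : 'cV[R]_n) (y : 'cV[R]_m) :
  dotv x (A^T *m y) = dotv y (A *m x).
Proof. by rewrite dotvC /dotv trmx_mul trmxK mulmxA. Qed.

Lemma dotv_col_mx n m (x x' : 'cV[R]_n) (y y' : 'cV[R]_m) :
  dotv (col_mx x y) (col_mx x' y') = dotv x x' + dotv y y'.
Proof. by rewrite /dotv tr_col_mx mul_row_col mxE. Qed.

Lemma sqnorm_ge0 n (u : 'cV[R]_n) : 0 <= sqnorm u.
Proof. by rewrite /sqnorm dotvE sumr_ge0// => i _; rewrite -expr2 sqr_ge0. Qed.

Lemma sqr_coord_le_sqnorm n (u : 'cV[R]_n) i : u i 0 ^+ 2 <= sqnorm u.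
Proof.
rewrite /sqnorm dotvE (bigD1 i)//= -expr2 lerDl sumr_ge0// => j _.
by rewrite -expr2 sqr_ge0.
Qed.

Lemma sqnorm_eq0 n (u : 'cV[R]_n) : sqnorm u = 0 -> u = 0.
Proof.
move=> u0; apply/colP => i; apply/eqP; rewrite mxE -sqrf_eq0.
by rewrite eq_le sqr_ge0 andbT -u0 sqr_coord_le_sqnorm.
Qed.

Lemma sqnormZ n (a : R) (u : 'cV[R]_n) : sqnorm (a *: u) = a ^+ 2 * sqnorm u.
Proof. by rewrite /sqnorm !dotv_lin mulrA. Qed.

Lemma sqnormB n (u v : 'cV[R]_n) :
  sqnorm (u - v) = sqnorm u - 2 * dotv u v + sqnorm v.
Proof. by rewrite /sqnorm !dotv_lin (dotvC v u); ring. Qed.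

End ScalarProduct.

(** * Convergence of sequences of vectors *)

Section VectorConvergence.
Context {R : realType}.

Lemma cvg_coordP {T} {G : set_system T} {GF : Filter G} n
    (u : T -> 'cV[R]_n) (l : 'cV[R]_n) :
  u @ G --> l <-> forall i, u k i 0 @[k --> G] --> l i 0.
Proof.
split=> [ul i|ul].
  by move: ul; apply: (@continuous_cvg _ _ _ _ _ u (fun M => M i 0)) => //;
    exact: coord_continuous.
apply/cvgrPdist_lt => e e0.
have : \near G, forall i, `|l i 0 - u G i 0| < e.
  apply: filter_forall => i.
  by have /cvgrPdist_lt := ul i; apply.
apply: filterS => k uk.
rewrite -[`|_|]/(mx_norm _) mx_normrE; apply/bigmax_ltP; split=> // -[i j] _ /=.
by rewrite ord1 !mxE.
Qed.

Lemma cvg_dotv {T} {G : set_system T} {GF : Filter G} n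
    (u v : T -> 'cV[R]_n) (a b : 'cV[R]_n) :
  u @ G --> a -> v @ G --> b -> dotv (u k) (v k) @[k --> G] --> dotv a b.
Proof.
move=> /cvg_coordP ua /cvg_coordP vb; rewrite dotvE.
under eq_fun do rewrite dotvE.
apply: cvg_big => [|i _]; first exact: add_continuous.
by apply: cvgM.
Qed.

Lemma cvg_mulmx {T} {G : set_system T} {GF : Filter G} n m (A : 'M[R]_(m, n))
    (u : T -> 'cV[R]_n) (a : 'cV[R]_n) :
  u @ G --> a -> A *m u k @[k --> G] --> A *m a.
Proof.
move=> /cvg_coordP ua; apply/cvg_coordP => i; rewrite mxE.
under eq_fun do rewrite mxE.
apply: cvg_big => [|j _]; first exact: add_continuous.
by apply: cvgM => //; exact: cvg_cst.
Qed.

Lemma cvg_mulmx0 {T} {G : set_system T} {GF : Filter G} n m (A : 'M[R]_(m, n))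
    (u : T -> 'cV[R]_n) :
  u @ G --> (0 : 'cV[R]_n) -> A *m u k @[k --> G] --> (0 : 'cV[R]_m).
Proof. by move/(@cvg_mulmx _ _ _ _ _ A); rewrite mulmx0. Qed.

Lemma cvg_usubmx {T} {G : set_system T} {GF : Filter G} n m
    (u : T -> 'cV[R]_(n + m)) (a : 'cV[R]_(n + m)) :
  u @ G --> a -> usubmx (u k) @[k --> G] --> usubmx a.
Proof.
move=> /cvg_coordP ua; apply/cvg_coordP => i; rewrite mxE.
by under eq_fun do rewrite mxE; exact: ua.
Qed.

Lemma cvg_dsubmx {T} {G : set_system T} {GF : Filter G} n m
    (u : T -> 'cV[R]_(n + m)) (a : 'cV[R]_(n + m)) :
  u @ G --> a -> dsubmx (u k) @[k --> G] --> dsubmx a.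
Proof.
move=> /cvg_coordP ua; apply/cvg_coordP => i; rewrite mxE.
by under eq_fun do rewrite mxE; exact: ua.
Qed.

Lemma cvg_sqnormP {T} {G : set_system T} {GF : Filter G} n
    (u : T -> 'cV[R]_n) (l : 'cV[R]_n) :
  u @ G --> l <-> sqnorm (u k - l) @[k --> G] --> 0.
Proof.
split=> [ul|ul].
  have -> : 0 = dotv (l - l) (l - l) by rewrite subrr dotv0.
  by apply: cvg_dotv; apply: cvgB => //; exact: cvg_cst.
apply/cvg_coordP => i; apply/cvgrPdist_lt => e e0.
have /cvgrPdist_lt /(_ (e ^+ 2)) := ul; rewrite exprn_gt0// => /(_ isT).
apply: filterS => k; rewrite sub0r normrN ger0_norm ?sqnorm_ge0// => uk.
rewrite -(@ltr_pXn2r _ 2)// ?nnegrE// ?ltW//; apply: le_lt_trans uk.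
rewrite distrC -normrX ger0_norm ?sqr_ge0//.
by have := sqr_coord_le_sqnorm (u k - l) i; rewrite !mxE.
Qed.

Lemma cvg_increasing_seq (f : nat -> nat) : increasing_seq f -> f @ \oo --> \oo.
Proof.
move=> /increasing_seqP fS; apply/cvgnyPge => N; exists N => // k /= Nk.
apply: leq_trans Nk _; elim: k => // k; rewrite -ltnS => /leq_trans; apply.
exact: fS.
Qed.

(** Bolzano-Weierstrass in finite dimension: the one-dimensional theorem is
    applied to one coordinate after the other, each time passing to a further
    subsequence, along which the coordinates already treated still converge. *)
Lemma bounded_cvg_subseq n (u : nat -> 'cV[R]_n) (C : R) :
  (forall k, sqnorm (u k) <= C) ->
  exists f : nat -> nat, f @ \oo --> \oo /\
    exists l : 'cV[R]_n, u (f k) @[k --> \oo] --> l.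
Proof.
move=> uC.
suff H (s : seq 'I_n) : exists f : nat -> nat, f @ \oo --> \oo /\
    forall i, i \in s -> exists l : R, u (f k) i 0 @[k --> \oo] --> l.
  have [f [foo fcvg]] := H (enum 'I_n).
  have /choice[l fl] i := fcvg i (mem_enum _ _).
  exists f; split=> //; exists (\col_i l i).
  by apply/cvg_coordP => i; rewrite mxE; exact: fl.
elim: s => [|i s [f [foo fs]]]; first by exists id; split.
have [|g /cvg_increasing_seq goo /cvg_ex[l gl]] :=
    @bolzano_weierstrass R (fun k => u (f k) i 0).
  (* |a| <= 1 + a^2 *)
  exists (1 + C); split; first exact: num_real.
  move=> x /ltW Cx k _; apply: le_trans Cx => /=.
  have := sqr_coord_le_sqnorm (u (f k)) i; have := uC (f k).
  by rewrite -real_normK ?num_real//; nra.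
exists (f \o g); split; first exact: cvg_comp foo.
move=> j; rewrite inE => /predU1P[->|/fs[l' fl']]; first by exists l.
by exists l'; exact: (cvg_comp _ _ goo fl').
Qed.

End VectorConvergence.

(** * Convex functions *)

Section Convexity.
Context {R : realType} {n : nat}.

Lemma convex_functionP (f : 'cV[R]_n -> R) (t : R) (x y : 'cV[R]_n) :
  convex_function setT f -> 0 <= t -> t <= 1 ->
  f (t *: x + (1 - t) *: y) <= t * f x + (1 - t) * f y.
Proof. by move=> cf t0 t1; exact: cf (Itv01 t0 t1) x y (mem_set I) (mem_set I). Qed.

Lemma convex_setP (C : set 'cV[R]_n) (t : R) (x y : 'cV[R]_n) :
  convex_set C -> 0 <= t -> t <= 1 -> C x -> C y ->
  C (t *: x + (1 - t) *: y).
Proof.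
move=> cC t0 t1 Cx Cy; apply: set_mem.
exact: cC x y (Itv01 t0 t1) (mem_set Cx) (mem_set Cy).
Qed.

(** The cube is enlarged one coordinate at a time: along the new coordinate,
    a point lies between the two translates of the smaller cube at distance [1],
    on both of which [f] is already bounded. *)
Let bounded_above_on_cube (f : 'cV[R]_n -> R) (s : seq 'I_n) :
  convex_function setT f -> forall x, exists M, forall z : 'cV[R]_n,
    (forall i, i \notin s -> z i 0 = 0) -> (forall i, `|z i 0| <= 1) ->
    f (x + z) <= M.
Proof.
move=> cf; elim: s => [|i s IHs] x.
  exists (f x) => z z0 _; suff -> : z = 0 by rewrite addr0.
  by apply/colP => i; rewrite z0// mxE.
have [M1 fM1] := IHs (x + delta_mx i 0); have [M2 fM2] := IHs (x - delta_mx i 0).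
exists (`|M1| + `|M2|) => z zs z1.
pose z' := z - z i 0 *: delta_mx i 0.
have z's j : j \notin s -> z' j 0 = 0.
  move=> js; rewrite !mxE eqxx andbT; have [->|ji] := eqVneq j i.
    by rewrite mulr1 subrr.
  by rewrite mulr0 subr0 zs// inE negb_or ji.
have z'1 j : `|z' j 0| <= 1.
  rewrite !mxE eqxx andbT; have [->|ji] := eqVneq j i.
    by rewrite mulr1 subrr normr0.
  by rewrite mulr0 subr0.
(* z i 0 is the barycentre of 1 and -1 with weights t and 1 - t *)
pose t := (1 + z i 0) / 2.
have /andP[zi1 zi2] : -1 <= z i 0 <= 1 by rewrite -ler_norml.
have [t0 t1] : 0 <= t /\ t <= 1 by rewrite /t; split; lra.
have -> : x + z = t *: (x + delta_mx i 0 + z') + (1 - t) *: (x - delta_mx i 0 + z').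
  by apply/colP => j; rewrite !mxE /t; field.
apply: le_trans (convex_functionP _ _ cf t0 t1) _.
have := fM1 z' z's z'1; have := fM2 z' z's z'1.
have := ler_norm M1; have := ler_norm M2; have := normr_ge0 M1; have := normr_ge0 M2.
nra.
Qed.

(** A finite convex function is bounded above on a cube around [x], because any
    point of the cube is a barycentre of its vertices.  Writing a point close to
    [x] as a barycentre of [x] and a point of the cube bounds [f] from above
    there, and writing [x] as a barycentre of that point and a point of the
    cube bounds [f] from below. *)
Lemma convex_function_continuous (f : 'cV[R]_n -> R) :
  convex_function setT f -> continuous f.
Proof.
move=> cf x; have [M fM] := bounded_above_on_cube (enum 'I_n) cf x.
have {}fM (z : 'cV[R]_n) : (forall i, `|z i 0| <= 1) -> f (x + z) <= M.
  by move=> z1; apply: fM => // i; rewrite mem_enum.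
have M0 : f x <= M by rewrite -[x]addr0 fM// => i; rewrite mxE normr0.
have near_le (t : R) (y : 'cV[R]_n) : 0 < t -> t <= 1 ->
    (forall i, `|y i 0 - x i 0| <= t) -> `|f y - f x| <= t * (M - f x).
  move=> t0 t1 yx; have tn0 : t != 0 by rewrite gt_eqF.
  pose z := t^-1 *: (y - x).
  have z1 i : `|z i 0| <= 1.
    by rewrite !mxE normrM gtr0_norm ?invr_gt0// ler_pdivrMl// mulr1.
  have fz1 := fM z z1.
  have fz2 : f (x + - z) <= M by apply: fM => i; rewrite mxE normrN.
  rewrite ler_norml; apply/andP; split.
    have t'0 : 0 < 1 + t by rewrite ltr_wpDr// ltW.
    have t'1 : (1 + t)^-1 <= 1 by rewrite invf_le1// lerDl ltW.
    have t'2 : 0 <= (1 + t)^-1 by rewrite invr_ge0 ltW.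
    have := convex_functionP y (x - z) cf t'2 t'1.
    have -> : (1 + t)^-1 *: y + (1 - (1 + t)^-1) *: (x - z) = x.
      apply/colP => i; rewrite !mxE; field.
      by rewrite tn0 gt_eqF.
    have -> : 1 - (1 + t)^-1 = t / (1 + t) by field; rewrite gt_eqF.
    rewrite mulrC mulrAC -mulrDl ler_pdivlMr//; nra.
  have := convex_functionP (x + z) x cf (ltW t0) t1.
  have -> : t *: (x + z) + (1 - t) *: x = y.
    by apply/colP => i; rewrite !mxE; field.
  nra.
apply/(@cvgrPdist_lt R R^o _ _ (nbhs_filter x)) => e e0.
pose t := Num.min 1 (e / (M - f x + 1)).
have M1 : 0 < M - f x + 1 by lra.
have t0 : 0 < t by rewrite lt_min ltr01 divr_gt0.
have t1 : t <= 1 by rewrite ge_min lexx.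
have te : t * (M - f x + 1) <= e.
  by rewrite -ler_pdivlMr// ge_min lexx orbT.
near=> y; rewrite distrC.
have xy : `|x - y| < t by near: y; exact: cvgr_dist_lt.
have : `|f y - f x| <= t * (M - f x).
  apply: near_le => // i; apply: ltW; apply: le_lt_trans xy.
  rewrite -[`|x - y|]/(mx_norm _) mx_normrE distrC.
  by apply: (bigmax_sup (i, 0)) => //=; rewrite !mxE.
nra.
Unshelve. all: by end_near. Qed.

(** First-order conditions are extracted in this form: an inequality along a
    segment is divided by the parameter [t], which then tends to [0]. *)
Lemma ge0_of_small_perturbation (g q : R) :
  (forall t, 0 < t -> t <= 1 -> 0 <= g + t * q) -> 0 <= g.
Proof.
move=> gq; rewrite leNgt; apply/negP => g0.
have q0 : 0 < q by have := gq 1 ltr01 (lexx _); lra.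
have t0 : 0 < - g / (2 * q) by rewrite divr_gt0// ?oppr_gt0// mulr_gt0.
have t1 : - g / (2 * q) <= 1.
  by rewrite ler_pdivrMr ?mulr_gt0// mul1r; have := gq 1 ltr01 (lexx _); lra.
have := gq _ t0 t1; have -> : g + - g / (2 * q) * q = g / 2.
  by field; rewrite gt_eqF.
lra.
Qed.

(** Optimality condition of a proximal step: along the segment from the
    minimizer [z] to [u], the quadratic term contributes its derivative at [z]
    up to second order, while convexity bounds the variation of [f]. *)
Lemma prox_variational_ineq (C : set 'cV[R]_n) (f : 'cV[R]_n -> R)
    (a b z : 'cV[R]_n) (r : R) :
  convex_set C -> convex_function setT f -> C z ->
  (forall u, C u -> f z + dotv z b + r / 2 * sqnorm (z - a)
                 <= f u + dotv u b + r / 2 * sqnorm (u - a)) ->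
  forall u, C u -> 0 <= f u - f z + dotv (u - z) (b + r *: (z - a)).
Proof.
move=> cC cf Cz zmin u Cu.
apply: (@ge0_of_small_perturbation _ (r / 2 * sqnorm (u - z))) => t t0 t1.
have := zmin _ (convex_setP cC (ltW t0) t1 Cu Cz).
have := convex_functionP u z cf (ltW t0) t1.
set v := _ + _.
have -> : dotv v b = dotv z b + t * dotv (u - z) b.
  by rewrite /v !dotv_lin; ring.
have -> : sqnorm (v - a) =
    sqnorm (z - a) + 2 * t * dotv (u - z) (z - a) + t ^+ 2 * sqnorm (u - z).
  have -> : v - a = (z - a) - (- t) *: (u - z).
    by apply/colP => i; rewrite !mxE; ring.
  by rewrite (sqnormB (z - a)) sqnormZ dotvZr (dotvC (z - a)); ring.
move=> fv zv; rewrite dotvDr dotvZr.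
rewrite -(@pmulr_rge0 _ t)//; nra.
Qed.

End Convexity.

(** * The largest eigenvalue of a Gram matrix *)

Section GramSpectrum.
Context {R : realType} {n m : nat}.
Variable A : 'M[R]_(m, n).

Lemma sqnorm_mulmx_eq0 : (forall x : 'cV[R]_n, sqnorm (A *m x) = 0) -> A = 0.
Proof.
move=> A0; apply/matrixP => i j; have /sqnorm_eq0 := A0 (delta_mx j 0).
by rewrite -colE => /colP/(_ i); rewrite !mxE.
Qed.

(** A maximizer [v] of the Rayleigh quotient exists by compactness of the
    sphere.  If [l] is the maximum, the form [l |x|^2 - |A x|^2] is nonnegative
    and vanishes at [v], so its differential vanishes there: [v] is an
    eigenvector for [l].  Conversely no eigenvalue exceeds [l]. *)
Lemma sqnorm_mulmx_le_rho (x : 'cV[R]_n) :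
  sqnorm (A *m x) <= rho (A^T *m A) * sqnorm x.
Proof.
have [->|xn0] := eqVneq x 0.
  by rewrite mulmx0 /sqnorm !dotv0 mulr0.
have sq_gt0 (y : 'cV[R]_n) : y != 0 -> 0 < sqnorm y.
  move=> y0; rewrite lt_neqAle sqnorm_ge0 andbT eq_sym.
  by apply: contra y0 => /eqP/sqnorm_eq0->.
pose S := [set v : 'rV[R]_n | sqnorm v^T = 1].
have cvg_tr (v : 'rV[R]_n) : y^T @[y --> v] --> v^T.
  apply/(@cvg_coordP _ _ _ (nbhs_filter v)) => i; rewrite mxE.
  by under eq_fun do rewrite mxE; exact: coord_continuous.
have cS : compact S.
  apply: bounded_closed_compact.
    exists 1; split; first exact: num_real.
    move=> M M1 v /= v1; apply: le_trans (ltW M1).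
    rewrite -[`|v|]/(mx_norm _) mx_normrE; apply/bigmax_leP; split=> // -[i j] _ /=.
    have := sqr_coord_le_sqnorm v^T j; rewrite v1 mxE ord1 -real_normK ?num_real//.
    by rewrite -[X in _ <= X](expr1n _ 2) ler_pXn2r ?nnegrE.
  have -> : S = (fun v : 'rV[R]_n => sqnorm v^T) @^-1` [set 1] by [].
  apply: preimage_closed; last exact: closed_eq.
  by move=> v _; apply: (@cvg_dotv _ _ _ (nbhs_filter v)); exact: cvg_tr.
have S0 : S !=set0.
  exists ((Num.sqrt (sqnorm x))^-1 *: x)^T.
  rewrite /S/= trmxK sqnormZ exprVn sqr_sqrtr ?sqnorm_ge0// mulVf// gt_eqF//.
  exact: sq_gt0.
have fcont : {within S, continuous (fun v : 'rV[R]_n => sqnorm (A *m v^T))}.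
  apply: continuous_subspaceT => v.
  by apply: (@cvg_dotv _ _ _ (nbhs_filter v));
    apply: (@cvg_mulmx _ _ _ (nbhs_filter v)); exact: cvg_tr.
have [v /set_mem vS vmax] := compact_EVT_max S0 cS fcont.
set l := sqnorm (A *m v^T) in vmax.
have lmax (y : 'cV[R]_n) : sqnorm (A *m y) <= l * sqnorm y.
  have [->|y0] := eqVneq y 0.
    by rewrite mulmx0 /sqnorm !dotv0 mulr0.
  have := vmax ((Num.sqrt (sqnorm y))^-1 *: y)^T.
  rewrite trmxK -scalemxAr sqnormZ exprVn sqr_sqrtr ?sqnorm_ge0//.
  rewrite mulrC ler_pdivrMr ?sq_gt0//; apply.
  apply: mem_set; rewrite /S/= trmxK sqnormZ exprVn sqr_sqrtr ?sqnorm_ge0//.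
  by rewrite mulVf// gt_eqF// sq_gt0.
apply: le_trans (lmax x) _; rewrite ler_wpM2r ?sqnorm_ge0//.
have vn0 : v != 0.
  apply: contraTneq isT => v0; move: vS; rewrite /S/= v0 trmx0 /sqnorm dotv0.
  by move=> /esym/eqP; rewrite oner_eq0.
apply: ub_le_sup.
  exists l => a /eigenvalueP[u ua u0].
  have un0 : u^T != 0.
    by apply: contra u0 => /eqP uT0; rewrite -[u]trmxK uT0 trmx0.
  have := lmax u^T; suff -> : sqnorm (A *m u^T) = a * sqnorm u^T.
    by rewrite ler_pM2r// sq_gt0.
  rewrite /sqnorm -dotv_trmul -dotvZr; congr dotv.
  by rewrite -linearZ/= -ua !trmx_mul trmxK -mulmxA.
apply/eigenvalueP; exists v => //; apply: trmx_inj.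
rewrite !trmx_mul trmxK linearZ/=; set x0 := v^T.
apply/eqP; rewrite -subr_eq0; apply/eqP; apply: sqnorm_eq0.
set h := _ - _.
(* the form at x0 + t h is nonnegative for all t, with linear term -2 t |h|^2 *)
have := sqnorm_ge0 h; rewrite le_eqVlt => /predU1P[//|h0]; exfalso.
suff : 0 <= - (2 * sqnorm h) by lra.
apply: (@ge0_of_small_perturbation R _ (l * sqnorm h - sqnorm (A *m h))) => t t0 t1.
have := lmax (x0 - (- t) *: h).
rewrite mulmxBr -scalemxAr (sqnormB x0) (sqnormB (A *m x0)) !sqnormZ !dotvZr.
have -> : dotv (A *m x0) (A *m h) = dotv h (A^T *m (A *m x0)) by rewrite dotv_trmul dotvC.
have -> : A^T *m (A *m x0) = h + l *: x0 by rewrite /h mulmxA subrK.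
rewrite dotvDr dotvZr -/(sqnorm h) (dotvC x0) vS => H.
rewrite -(@pmulr_rge0 _ t)//; move: H; rewrite -/l; nra.
Qed.

(** This keeps the threshold [rmin] away from [0]. *)
Lemma rho_gt0 : A != 0 -> 0 < rho (A^T *m A).
Proof.
move=> A0; rewrite ltNge; apply: contraNN A0 => r0; apply/eqP.
apply: sqnorm_mulmx_eq0 => x; apply/eqP; rewrite eq_le sqnorm_ge0 andbT.
by apply: le_trans (sqnorm_mulmx_le_rho x) _; rewrite mulr_le0_ge0 ?sqnorm_ge0.
Qed.

Lemma mxtrace_gram_gt0 : A != 0 -> 0 < \tr (A^T *m A).
Proof.
move=> A0; have E : \tr (A^T *m A) = \sum_j sqnorm (col j A).
  rewrite /mxtrace; apply: eq_bigr => j _; rewrite mxE /sqnorm dotvE.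
  by apply: eq_bigr => i _; rewrite !mxE.
have E0 : 0 <= \tr (A^T *m A) by rewrite E sumr_ge0// => j _; exact: sqnorm_ge0.
rewrite lt_neqAle E0 andbT eq_sym; apply: contra A0; rewrite E psumr_eq0; last first.
  by move=> j _; exact: sqnorm_ge0.
move=> /allP A0; apply/eqP/matrixP => i j.
have /= := A0 j (mem_index_enum _) => /eqP/sqnorm_eq0/colP/(_ i).
by rewrite !mxE.
Qed.

End GramSpectrum.

Lemma rho_average_gram_gt0 (R : realType) n m (A : 'M[R]_(m, n)) :
  A != 0 -> 0 < rho_average (A^T *m A).
Proof.
move=> A0; rewrite /rho_average divr_gt0 ?mxtrace_gram_gt0// ltr0n lt0n.
apply: contraNN A0 => /eqP n0; apply/eqP/matrixP => i j.
by have := ltn_ord j; rewrite [X in (_ < X)%N]n0.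
Qed.

(** * Fejer monotone sequences *)

Section Fejer.
Context {R : realType} {N : nat}.
Variable H : 'M[R]_N.

(** One relaxed step along [z].  The step length [phi / |z|_H^2] would minimize
    the upper bound [|u|_H^2 - 2 c phi + c^2 |z|_H^2] over [c]; over-relaxing it
    by [gamma < 2] retains the fraction [gamma (2 - gamma)] of the decrease. *)
Lemma relaxed_step_decrease (u z : 'cV[R]_N) (phi gamma C : R) :
  H^T = H -> 0 < gamma < 2 -> 0 < C -> 0 < sqnormH H z ->
  sqnormH H z <= C * phi -> phi <= dotv u (H *m z) ->
  sqnormH H (u - (gamma * (phi / sqnormH H z)) *: z)
    <= sqnormH H u - gamma * (2 - gamma) / C * phi.
Proof.
move=> HT /andP[g0 g2] C0; set q := sqnormH H z => q0 qC phiu.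
have phi0 : 0 < phi by rewrite -(pmulr_rgt0 _ C0); exact: lt_le_trans qC.
set c := gamma * (phi / q); have c0 : 0 < c by rewrite mulr_gt0// divr_gt0.
have -> : sqnormH H (u - c *: z) = sqnormH H u - 2 * c * dotv u (H *m z) + c ^+ 2 * q.
  rewrite /q /sqnormH mulmxBr -scalemxAr !dotv_lin.
  have -> : dotv z (H *m u) = dotv u (H *m z) by rewrite -dotv_trmul HT.
  by ring.
have cq : c * q = gamma * phi by rewrite /c; field; rewrite gt_eqF.
have c2 : c ^+ 2 * q = gamma * phi * c by rewrite expr2 -mulrA cq mulrC.
have cC : gamma / C <= c.
  by rewrite /c ler_pM2l// ler_pdivlMr// mulrC ler_pdivrMr// mulrC.
rewrite c2.
have -> : gamma * (2 - gamma) / C * phi = (gamma / C) * ((2 - gamma) * phi).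
  by field; rewrite gt_eqF.
have : (gamma / C) * ((2 - gamma) * phi) <= c * ((2 - gamma) * phi).
  by rewrite ler_wpM2r// mulr_ge0 ?subr_ge0 ?(ltW g2) ?(ltW phi0).
nra.
Qed.

(** Every [|w k - p|_H] with [p] in [S] decreases, hence converges, and the
    decrease forces [w k - wt k] to vanish.  A cluster point [l] of [w] exists
    by boundedness and lies in [S]; as [|w k - l|_H] converges and tends to [0]
    along a subsequence, its limit is [0]. *)
Lemma fejer_cvg (c1 c : R) (S : set 'cV[R]_N) (w wt : nat -> 'cV[R]_N) :
  0 < c1 -> (forall u, c1 * sqnorm u <= sqnormH H u) -> 0 < c ->
  (forall p, S p -> forall k,
    sqnormH H (w k.+1 - p) <= sqnormH H (w k - p) - c * sqnorm (w k - wt k)) ->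
  S !=set0 ->
  (forall (f : nat -> nat) l, w (f k) @[k --> \oo] --> l ->
     w (f k) - wt (f k) @[k --> \oo] --> (0 : 'cV[R]_N) -> S l) ->
  exists2 p, S p & w @ \oo --> p.
Proof.
move=> c10 Hc1 c0 dec [p Sp] lim.
have H_ge0 u : 0 <= sqnormH H u.
  by apply: le_trans (Hc1 u); rewrite mulr_ge0 ?sqnorm_ge0// ltW.
have mono q : S q -> nonincreasing_seq (fun k => sqnormH H (w k - q)).
  move=> Sq; apply/nonincreasing_seqP => k; apply: le_trans (dec q Sq k) _.
  by rewrite lerBlDr lerDl mulr_ge0 ?sqnorm_ge0// ltW.
have Ecvg q : S q -> exists e : R, sqnormH H (w k - q) @[k --> \oo] --> e.
  move=> Sq; apply/cvg_ex; apply: nonincreasing_is_cvgn; first exact: mono.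
  by exists 0 => _ [k _ <-].
have d0 : w k - wt k @[k --> \oo] --> (0 : 'cV[R]_N).
  apply/cvg_sqnormP; under eq_fun do rewrite subr0.
  have [e Ee] := Ecvg p Sp.
  pose E k := sqnormH H (w k - p).
  have : c^-1 * (E k - E k.+1) @[k --> \oo] --> c^-1 * (e - e).
    by apply: cvgM; [exact: cvg_cst|apply: cvgB => //; rewrite (cvg_shiftS E)].
  rewrite subrr mulr0; apply: (squeeze_cvgr _ (cvg_cst 0)).
  apply: nearW => k; rewrite sqnorm_ge0/= mulrC ler_pdivlMr//.
  by have := dec p Sp k; rewrite /E; lra.
have [k|f [foo [l fl]]] := @bounded_cvg_subseq R N (fun k => w k - p)
    (sqnormH H (w 0%N - p) / c1).
  rewrite ler_pdivlMr// mulrC; apply: le_trans (Hc1 _) _.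
  exact: (mono p Sp 0%N k).
have {}fl : w (f k) @[k --> \oo] --> l + p.
  have -> : (fun k => w (f k)) = (fun k => (w (f k) - p) + p).
    by apply/funext => k; rewrite subrK.
  by apply: cvgD => //; exact: cvg_cst.
have Sl : S (l + p) by apply: (lim f) => //; exact: (cvg_comp _ _ foo d0).
exists (l + p) => //; move: (l + p) Sl fl => q Sq fq.
have [e Ee] := Ecvg q Sq.
have e0 : e = 0.
  have Efe : sqnormH H (w (f k) - q) @[k --> \oo] --> e := cvg_comp _ _ foo Ee.
  apply: (cvg_unique _ Efe) => //.
  have -> : 0 = dotv (q - q) (H *m (q - q)) by rewrite subrr mulmx0 dotv0.
  have wq : w (f k) - q @[k --> \oo] --> q - q by apply: cvgB => //; exact: cvg_cst.
  by apply: cvg_dotv => //; exact: cvg_mulmx.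
apply/cvg_sqnormP.
have : c1^-1 * sqnormH H (w k - q) @[k --> \oo] --> c1^-1 * 0.
  by apply: cvgM; [exact: cvg_cst|rewrite -e0].
rewrite mulr0; apply: (squeeze_cvgr _ (cvg_cst 0)).
by apply: nearW => k; rewrite sqnorm_ge0/= mulrC ler_pdivlMr// mulrC.
Qed.

End Fejer.

(** * The matrices of the algorithm *)

Section Matrices.
Context {R : realType} {n m : nat}.
Variable A : 'M[R]_(m, n).

Lemma sqnorm_col_mx (x : 'cV[R]_n) (y : 'cV[R]_m) :
  sqnorm (col_mx x y) = sqnorm x + sqnorm y.
Proof. exact: dotv_col_mx. Qed.

Lemma Q_DP_col_mx (s r : R) (x : 'cV[R]_n) (y : 'cV[R]_m) :
  Q_DP A s r *m col_mx x y = col_mx (r *: x) (s *: y - A *m x).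
Proof. by rewrite mul_block_col !mul_scalar_mx mul0mx addr0 mulNmx addrC. Qed.

Lemma M_DP_col_mx (s ra r : R) (x : 'cV[R]_n) (y : 'cV[R]_m) :
  M_DP A s ra r *m col_mx x y = col_mx ((r / ra) *: x) (y - (1 / s) *: (A *m x)).
Proof.
by rewrite mul_block_col !mul_scalar_mx mul0mx addr0 scale1r mulNmx -scalemxAl addrC.
Qed.

Lemma H_DP_col_mx (s ra : R) (x : 'cV[R]_n) (y : 'cV[R]_m) :
  H_DP s ra *m col_mx x y = col_mx (ra *: x) (s *: y).
Proof. by rewrite mul_block_col !mul_scalar_mx !mul0mx addr0 add0r. Qed.

Lemma sqnormH_DP_col_mx (s ra : R) (x : 'cV[R]_n) (y : 'cV[R]_m) :
  sqnormH (H_DP s ra) (col_mx x y) = ra * sqnorm x + s * sqnorm y.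
Proof. by rewrite /sqnormH H_DP_col_mx dotv_col_mx !dotvZr. Qed.

Lemma tr_H_DP (s ra : R) : (H_DP s ra : 'M[R]_(n + m))^T = H_DP s ra.
Proof. by rewrite /H_DP tr_block_mx !tr_scalar_mx !trmx0. Qed.

Lemma H_DP_mul_M_DP (s ra r : R) (d : 'cV[R]_(n + m)) : s != 0 -> ra != 0 ->
  H_DP s ra *m (M_DP A s ra r *m d) = Q_DP A s r *m d.
Proof.
move=> s0 ra0; rewrite -[d]vsubmxK M_DP_col_mx H_DP_col_mx Q_DP_col_mx.
by rewrite scalerBr !scalerA mulrCA mulfV// mulr1 div1r mulfV// scale1r.
Qed.

Lemma sqnormH_DP_ge (s ra : R) (u : 'cV[R]_(n + m)) :
  Num.min ra s * sqnorm u <= sqnormH (H_DP s ra) u.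
Proof.
rewrite -[u]vsubmxK sqnormH_DP_col_mx sqnorm_col_mx mulrDr lerD// ler_wpM2r ?sqnorm_ge0//.
  by rewrite ge_min lexx.
by rewrite ge_min lexx orbT.
Qed.

Section RelaxedCondition.
Variables (s ra r nu : R) (d : 'cV[R]_(n + m)).
Hypotheses (s0 : 0 < s) (ra0 : 0 < ra) (r0 : 0 < r) (nu1 : nu < 1).
Hypothesis relaxed :
  1 / s * sqnorm (A *m usubmx d) <= nu * r * sqnorm (usubmx d).

Let relaxed1 : sqnorm (A *m usubmx d) / s <= r * sqnorm (usubmx d).
Proof.
rewrite mulrC -div1r; apply: le_trans relaxed _.
by rewrite -mulrA ler_piMl ?(ltW nu1)// mulr_ge0 ?sqnorm_ge0// ltW.
Qed.

(** Young's inequality absorbs the cross term [dy^T A dx] of the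
    quadratic form of [Q_DP] into half of its diagonal terms. *)
Lemma Q_DP_coercive :
  (r * sqnorm (usubmx d) + s * sqnorm (dsubmx d)) / 2 <= dotv d (Q_DP A s r *m d).
Proof.
rewrite -{3 4}[d]vsubmxK Q_DP_col_mx dotv_col_mx !dotv_lin -!/(sqnorm _).
have young : 2 * dotv (dsubmx d) (A *m usubmx d) <=
    s * sqnorm (dsubmx d) + sqnorm (A *m usubmx d) / s.
  have : 0 <= sqnorm (s *: dsubmx d - A *m usubmx d) / s.
    by rewrite divr_ge0 ?sqnorm_ge0// ltW.
  rewrite sqnormB sqnormZ dotvZl.
  have -> : (s ^+ 2 * sqnorm (dsubmx d) - 2 * (s * dotv (dsubmx d) (A *m usubmx d))
      + sqnorm (A *m usubmx d)) / s = s * sqnorm (dsubmx d)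
      - 2 * dotv (dsubmx d) (A *m usubmx d) + sqnorm (A *m usubmx d) / s.
    by field; rewrite gt_eqF.
  by lra.
have := relaxed1; lra.
Qed.

Lemma sqnormH_M_DP_le :
  sqnormH (H_DP s ra) (M_DP A s ra r *m d) <=
  (r / ra + 2) * (r * sqnorm (usubmx d) + s * sqnorm (dsubmx d)).
Proof.
rewrite -{1}[d]vsubmxK M_DP_col_mx sqnormH_DP_col_mx sqnormZ.
set X2 := sqnorm (usubmx d); set Y2 := sqnorm (dsubmx d).
have X20 : 0 <= X2 by exact: sqnorm_ge0.
have Y20 : 0 <= Y2 by exact: sqnorm_ge0.
have -> : ra * ((r / ra) ^+ 2 * X2) = r / ra * (r * X2) by field; rewrite gt_eqF.
have : s * sqnorm (dsubmx d - (1 / s) *: (A *m usubmx d)) <=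
    2 * (s * Y2) + 2 * (sqnorm (A *m usubmx d) / s).
  have : 0 <= s * sqnorm (dsubmx d - (- (1 / s)) *: (A *m usubmx d)).
    by rewrite mulr_ge0 ?sqnorm_ge0// ltW.
  rewrite !sqnormB !sqnormZ !dotvZr -/Y2.
  have -> : (- (1 / s)) ^+ 2 = (1 / s) ^+ 2 by rewrite sqrrN.
  have -> : sqnorm (A *m usubmx d) / s = s * ((1 / s) ^+ 2 * sqnorm (A *m usubmx d)).
    by field; rewrite gt_eqF.
  by lra.
have ra_r : 0 <= r / ra by rewrite divr_ge0 ?ltW.
have : 0 <= r / ra * (s * Y2) by rewrite mulr_ge0// mulr_ge0// ltW.
move: relaxed1; rewrite -/X2; lra.
Qed.

Lemma sqnormH_M_DP_gt0 : d != 0 -> 0 < sqnormH (H_DP s ra) (M_DP A s ra r *m d).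
Proof.
move=> dn0; set z := M_DP A s ra r *m d.
have z_ge : Num.min ra s * sqnorm z <= sqnormH (H_DP s ra) z by exact: sqnormH_DP_ge.
have mn0 : 0 < Num.min ra s by rewrite lt_min ra0 s0.
apply: lt_le_trans z_ge; rewrite mulr_gt0// lt_neqAle sqnorm_ge0 andbT eq_sym.
apply: contra dn0 => /eqP/sqnorm_eq0 z0; apply/eqP.
have := Q_DP_coercive; rewrite -(@H_DP_mul_M_DP s ra r) ?gt_eqF// -/z z0.
rewrite mulmx0 dotv0 => E.
have := sqnorm_ge0 (usubmx d); have := sqnorm_ge0 (dsubmx d) => Y2 X2.
have X20 : r * sqnorm (usubmx d) = 0.
  by have := mulr_ge0 (ltW r0) X2; have := mulr_ge0 (ltW s0) Y2; lra.
have Y20 : s * sqnorm (dsubmx d) = 0.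
  by have := mulr_ge0 (ltW r0) X2; have := mulr_ge0 (ltW s0) Y2; lra.
move: X20 Y20 => /eqP + /eqP; rewrite !mulf_eq0 (gt_eqF r0) (gt_eqF s0)/=.
move=> /eqP/sqnorm_eq0 x0 /eqP/sqnorm_eq0 y0.
by rewrite -[d]vsubmxK x0 y0 col_mx0.
Qed.

End RelaxedCondition.
End Matrices.

(** * The variational inequality *)

Section VariationalInequality.
Context {R : realType} {n m : nat}.
Variables (A : 'M[R]_(m, n)) (theta1 : 'cV[R]_n -> R) (theta2 : 'cV[R]_m -> R).
Variables (X : set 'cV[R]_n) (Y : set 'cV[R]_m).

Lemma F_mulmx (w : 'cV[R]_(n + m)) : F A w = block_mx 0 (- A^T) A 0 *m w.
Proof. by rewrite -{2}[w]vsubmxK mul_block_col !mul0mx addr0 add0r mulNmx. Qed.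

Lemma dotv_F (w : 'cV[R]_(n + m)) : dotv w (F A w) = 0.
Proof. by rewrite -{1}[w]vsubmxK dotv_col_mx dotvNr dotv_trmul addNr. Qed.

Lemma dotv_subr_F (u v : 'cV[R]_(n + m)) :
  dotv (u - v) (F A u) = dotv (u - v) (F A v).
Proof.
apply/eqP; rewrite -subr_eq0 -dotvNr -dotvDr !F_mulmx -mulmxBr -F_mulmx.
by rewrite dotv_F.
Qed.

(** Adding the optimality conditions of the two proximal steps gives the
    variational inequality of the problem at [wt], perturbed by a term linear
    in [w - wt]; the off-diagonal block of [Q_DP] is there because the dual step
    uses [A x] where the inequality at [wt] has [A xt]. *)
Lemma prediction_variational_ineq (s r : R) (w wt : 'cV[R]_(n + m)) :
  convex_function setT theta1 -> convex_function setT theta2 ->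
  convex_set X -> convex_set Y ->
  ytilde_step A theta1 theta2 Y s (usubmx w) (dsubmx w) (dsubmx wt) ->
  xtilde_step A theta1 theta2 X r (usubmx w) (dsubmx wt) (usubmx wt) ->
  forall u, Omega X Y u ->
  dotv (u - wt) (Q_DP A s r *m (w - wt)) <=
    thetaw theta1 theta2 u - thetaw theta1 theta2 wt + dotv (u - wt) (F A wt).
Proof.
move=> c1 c2 cX cY [Yyt ymax] [Xxt xmin] u [Xu Yu].
rewrite -[u]vsubmxK -[w]vsubmxK -[wt]vsubmxK /thetaw /F !(col_mxKu, col_mxKd).
move: (usubmx u) (dsubmx u) (usubmx w) (dsubmx w) (usubmx wt) (dsubmx wt)
  Yyt ymax Xxt xmin Xu Yu => ux uy x y xt yt Yyt ymax Xxt xmin Xu Yu.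
rewrite !opp_col_mx !add_col_mx Q_DP_col_mx !dotv_col_mx.
have /(_ uy Yu) : forall v, Y v ->
    0 <= theta2 v - theta2 yt + dotv (v - yt) (A *m x + s *: (yt - y)).
  apply: prox_variational_ineq => // v Yv; have := ymax v Yv; rewrite /Phi /=; lra.
have /(_ ux Xu) : forall v, X v ->
    0 <= theta1 v - theta1 xt + dotv (v - xt) (- (A^T *m yt) + r *: (xt - x)).
  apply: prox_variational_ineq => // v Xv; have := xmin v Xv.
  by rewrite /Phi /= !dotvNr !dotv_trmul; lra.
rewrite mulmxBr !dotv_lin; lra.
Qed.

(** Testing the inequality of [prediction_variational_ineq] with a solution [p],
    and using that [p] solves the unperturbed one. *)
Lemma dotv_Q_DP_solution (s r : R) (w wt p : 'cV[R]_(n + m)) :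
  (forall u, Omega X Y u -> dotv (u - wt) (Q_DP A s r *m (w - wt)) <=
    thetaw theta1 theta2 u - thetaw theta1 theta2 wt + dotv (u - wt) (F A wt)) ->
  Omega X Y wt -> Omega_star A theta1 theta2 X Y p ->
  dotv (w - wt) (Q_DP A s r *m (w - wt)) <= dotv (w - p) (Q_DP A s r *m (w - wt)).
Proof.
move=> VI Owt [Op /(_ wt Owt)]; rewrite -dotv_subr_F => pwt.
have := VI p Op; set q := _ *m (w - wt).
have -> : w - p = (w - wt) - (p - wt) by rewrite opprB addrA subrK.
rewrite (dotvDl (w - wt)) (dotvNl (p - wt)).
by move: pwt; rewrite -(opprB p wt) (dotvNl (p - wt)); lra.
Qed.

(** Passing to the limit in the perturbed inequality, whose perturbation
    vanishes when the parameters [r] stay bounded. *)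
Lemma limit_Omega_star (s rhi : R) (r : nat -> R) (w wt : nat -> 'cV[R]_(n + m))
    (l : 'cV[R]_(n + m)) :
  convex_function setT theta1 -> convex_function setT theta2 ->
  closed X -> closed Y ->
  (forall k, Omega X Y (wt k)) -> (forall k, 0 <= r k <= rhi) ->
  (forall k u, Omega X Y u -> dotv (u - wt k) (Q_DP A s (r k) *m (w k - wt k)) <=
    thetaw theta1 theta2 u - thetaw theta1 theta2 (wt k) +
    dotv (u - wt k) (F A (wt k))) ->
  w @ \oo --> l -> w k - wt k @[k --> \oo] --> (0 : 'cV[R]_(n + m)) ->
  Omega_star A theta1 theta2 X Y l.
Proof.
move=> c1 c2 clX clY Owt rb VI wl d0.
have wtl : wt @ \oo --> l.
  have -> : wt = (fun k => w k - (w k - wt k)) by apply/funext => k; rewrite subKr.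
  by rewrite -[l]subr0; apply: cvgB.
have xtl : usubmx (wt k) @[k --> \oo] --> usubmx l by exact: cvg_usubmx.
have ytl : dsubmx (wt k) @[k --> \oo] --> dsubmx l by exact: cvg_dsubmx.
split.
  split; [apply: (closed_cvg X clX _ _ xtl)|apply: (closed_cvg Y clY _ _ ytl)];
    by apply: nearW => k; case: (Owt k).
move=> u Ou.
have Qd0 : Q_DP A s (r k) *m (w k - wt k) @[k --> \oo] --> (0 : 'cV[R]_(n + m)).
  have -> : (fun k => Q_DP A s (r k) *m (w k - wt k)) =
      (fun k => r k *: (block_mx 1%:M 0 0 0 *m (w k - wt k)) +
                Q_DP A s 0 *m (w k - wt k)).
    apply/funext => k; rewrite -[w k - wt k]vsubmxK !Q_DP_col_mx mul_block_col.
    by rewrite !mul0mx mul1mx scale_col_mx add_col_mx !addr0 scaler0 add0r scale0r addr0.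
  rewrite -[X in _ --> X]addr0; apply: cvgD; last first.
    exact: cvg_mulmx0.
  pose v k := block_mx 1%:M 0 0 0 *m (w k - wt k) : 'cV[R]_(n + m).
  have /cvg_sqnormP v0 : v @ \oo --> (0 : 'cV[R]_(n + m)).
    exact: cvg_mulmx0.
  apply/cvg_sqnormP.
  have : rhi ^+ 2 * sqnorm (v k - 0) @[k --> \oo] --> rhi ^+ 2 * 0.
    by apply: cvgM => //; exact: cvg_cst.
  rewrite mulr0; apply: (squeeze_cvgr _ (cvg_cst 0)); apply: nearW => k.
  rewrite sqnorm_ge0/= !subr0 sqnormZ ler_wpM2r ?sqnorm_ge0//.
  by have /andP[r0 r1] := rb k; rewrite ler_pXn2r// nnegrE// (le_trans r0).
have uwt : u - wt k @[k --> \oo] --> u - l by apply: cvgB => //; exact: cvg_cst.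
have : thetaw theta1 theta2 u - thetaw theta1 theta2 (wt k)
      + dotv (u - wt k) (F A (wt k)) - dotv (u - wt k) (Q_DP A s (r k) *m (w k - wt k))
    @[k --> \oo] -->
    thetaw theta1 theta2 u - thetaw theta1 theta2 l + dotv (u - l) (F A l)
      - dotv (u - l) 0.
  apply: cvgB; last exact: cvg_dotv.
  apply: cvgD; last first.
    apply: cvg_dotv => //; rewrite F_mulmx.
    by under eq_fun do rewrite F_mulmx; exact: cvg_mulmx.
  apply: cvgB; first exact: cvg_cst.
  apply: cvgD.
    by apply: (continuous_cvg _ _ xtl); exact: convex_function_continuous.
  by apply: (continuous_cvg _ _ ytl); exact: convex_function_continuous.
rewrite dotv0 subr0 => /cvgr_to_ge; apply.
by apply: nearW => k; rewrite subr_ge0; exact: VI.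
Qed.

End VariationalInequality.

(** * The adaptive parameters *)

Section StepSizes.
Context {R : realType} {n m : nat}.
Variables (A : 'M[R]_(m, n)) (theta1 : 'cV[R]_n -> R) (theta2 : 'cV[R]_m -> R).
Variables (X : set 'cV[R]_n) (Y : set 'cV[R]_m).

(** A pass of the loop multiplies [r] by [t theta > nu theta > 1], and gives it
    the value [theta |A dx|^2 / (s |dx|^2)], at most [theta rho(A^T A) / s]
    whatever the value before the pass. *)
Lemma adjust_bounds (s nu theta : R) (x : 'cV[R]_n) (yt : 'cV[R]_m)
    (r r' : R) (xt : 'cV[R]_n) :
  0 < s -> 0 < nu -> 1 / nu < theta ->
  adjust A theta1 theta2 X s nu theta x yt r r' xt -> 0 < r ->
  [/\ xtilde_step A theta1 theta2 X r' x yt xt, r <= r' &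
      r' <= Num.max r (theta * rho (A^T *m A) / s)].
Proof.
move=> s0 nu0 nut; have th0 : 0 < theta by apply: lt_trans nut; rewrite divr_gt0.
elim=> {r r' xt} [r xt step _ _|r xt r' xt' _ nur _ IH r0].
  by split=> //; rewrite le_max lexx.
have t1 : 1 < Defs.ratio A s r x xt * theta.
  by rewrite ltr_pdivrMr// in nut; apply: lt_trans nut _; rewrite mulrC ltr_pM2r.
have r1 : r < r * Defs.ratio A s r x xt * theta by rewrite -mulrA ltr_pMr.
have [step rr' r'le] := IH (lt_trans r0 r1).
split=> //; first exact: le_trans (ltW r1) rr'.
apply: le_trans r'le _; rewrite ge_max; apply/andP; split; last first.
  by rewrite le_max lexx orbT.
rewrite le_max; apply/orP; right.
move: nur; rewrite /Defs.ratio; case: ifPn => [_|xtx _]; first by rewrite ltNge (ltW nu0).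
set d := x - xt; have d0 : 0 < sqnorm d.
  rewrite lt_neqAle sqnorm_ge0 andbT eq_sym; apply: contra xtx => /eqP/sqnorm_eq0/eqP.
  by rewrite subr_eq0 eq_sym.
have -> : r * (1 / s * sqnorm (A *m d) / (r * sqnorm d)) * theta =
    theta / s * (sqnorm (A *m d) / sqnorm d) by field; rewrite !gt_eqF.
have -> : theta * rho (A^T *m A) / s = theta / s * rho (A^T *m A) by ring.
rewrite ler_pM2l ?divr_gt0// ler_pdivrMr//; exact: sqnorm_mulmx_le_rho.
Qed.

Section Positivity.
Hypothesis A0 : A != 0.

Lemma s_of_gt0 (tau : R) : 0 < tau -> 0 < s_of A tau.
Proof.
move=> tau0; rewrite mulr_gt0// -{1}[A]trmxK.
apply: rho_average_gram_gt0.
by apply: contra A0 => /eqP AT0; rewrite -[A]trmxK AT0 trmx0.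
Qed.

Lemma ra_of_gt0 (tau kappa : R) : 0 < tau -> 0 < kappa -> 0 < ra_of A tau kappa.
Proof.
move=> tau0 kappa0; have a0 := rho_average_gram_gt0 A0.
exact: mulr_gt0 (mulr_gt0 (divr_gt0 ltr01 (s_of_gt0 tau0)) kappa0) a0.
Qed.

Lemma r0_of_gt0 (tau : R) : 0 < tau -> 0 < r0_of A tau.
Proof.
move=> tau0; have a0 := rho_average_gram_gt0 A0.
by apply: mulr_gt0 a0; rewrite divr_gt0// mulr_gt0// s_of_gt0.
Qed.

Lemma rmin_of_gt0 (tau kappa : R) : 0 < tau -> 0 < kappa -> 0 < rmin_of A tau kappa.
Proof.
move=> tau0 kappa0; rewrite mulr_gt0 ?ra_of_gt0// sqrtr_gt0 divr_gt0 ?rho_gt0//.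
exact: rho_average_gram_gt0.
Qed.

(** The relaxation rule never brings [r] below [rmin], nor above its previous
    value, so both bounds of [adjust_bounds] persist along the iterations. *)
Lemma stepsize_bounds (tau kappa gamma nu mu theta : R)
    (w wt : nat -> 'cV[R]_(n + m)) (rini r : nat -> R) :
  0 < tau -> 0 < kappa -> 0 < nu -> 1 / nu < theta ->
  generated_by_adaptive_dual_PDHG A theta1 theta2 X Y
    tau kappa gamma nu mu theta w wt rini r ->
  exists rlo rhi, 0 < rlo /\ forall k, rlo <= r k <= rhi /\
    xtilde_step A theta1 theta2 X (r k) (usubmx (w k)) (dsubmx (wt k)) (usubmx (wt k)).
Proof.
move=> tau0 kappa0 nu0 nut gen.
pose rlo := Num.min (r0_of A tau) (rmin_of A tau kappa).
pose rhi := Num.max (r0_of A tau) (theta * rho (A^T *m A) / s_of A tau).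
have rlo0 : 0 < rlo by rewrite lt_min r0_of_gt0// rmin_of_gt0.
exists rlo, rhi; split=> //.
have step k : rlo <= rini k <= rhi -> rlo <= r k <= rhi /\
    xtilde_step A theta1 theta2 X (r k) (usubmx (w k)) (dsubmx (wt k)) (usubmx (wt k)).
  move=> /andP[lok hik].
  have [stp lo hi] := adjust_bounds (s_of_gt0 tau0) nu0 nut (gen_xtilde gen k)
    (lt_le_trans rlo0 lok).
  split=> //; rewrite (le_trans lok lo)/=; apply: le_trans hi _.
  by rewrite ge_max hik le_max lexx orbT.
move=> k; apply: (step k); elim: k => [|k /step[/andP[lok hik] _]].
  by rewrite (gen_init gen) ge_min lexx le_max lexx.
rewrite (gen_relax gen); case: ifPn => [/andP[_ rmin_lt]|_]; last by rewrite lok.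
apply/andP; split; first by rewrite le_max [X in _ || X]ge_min lexx !orbT.
apply: le_trans hik; rewrite ge_max (ltW rmin_lt) andbT.
have := lt_le_trans rlo0 lok; lra.
Qed.

End Positivity.
End StepSizes.

Theorem theorem3p1 (R : realType) (n m : nat) (A : 'M[R]_(m, n))
    (theta1 : 'cV[R]_n -> R) (theta2 : 'cV[R]_m -> R)
    (X : set 'cV[R]_n) (Y : set 'cV[R]_m)
    (tau kappa gamma nu mu theta : R)
    (w wt : nat -> 'cV[R]_(n + m)) (rini r : nat -> R)
    (A_neq0 : A != 0)
    (theta1_convex : convex_function setT theta1)
    (theta2_convex : convex_function setT theta2)
    (X_closed : closed X) (X_convex : convex_set X)
    (Y_closed : closed Y) (Y_convex : convex_set Y)
    (sol_nonempty : Omega_star A theta1 theta2 X Y !=set0)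
    (tau_bounds : 1 / 5 <= tau <= 5)
    (kappa_bounds : 1 / 10 <= kappa <= 10)
    (gamma_bounds : 0 < gamma < 2)
    (nu_bounds : 0 < nu < 1)
    (mu_bounds : 0 < mu < nu)
    (theta_bound : 1 / nu < theta)
    (generated : generated_by_adaptive_dual_PDHG A theta1 theta2 X Y
                   tau kappa gamma nu mu theta w wt rini r)
    (no_stop : forall k, w k <> wt k)
    (relaxed : forall k,
       1 / s_of A tau * sqnorm (A *m (usubmx (w k) - usubmx (wt k)))
         <= nu * r k * sqnorm (usubmx (w k) - usubmx (wt k))) :
  exists2 winf : 'cV[R]_(n + m),
    Omega_star A theta1 theta2 X Y winf & w @ \oo --> winf.
Proof.
have tau0 : 0 < tau by case/andP: tau_bounds; lra.
have kappa0 : 0 < kappa by case/andP: kappa_bounds; lra.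
have [g0 g2] := andP gamma_bounds; have [nu0 nu1] := andP nu_bounds.
have s0 := s_of_gt0 A_neq0 tau0; set s := s_of A tau in s0 relaxed.
have ra0 := ra_of_gt0 A_neq0 tau0 kappa0; set ra := ra_of A tau kappa in ra0.
have [rlo [rhi [rlo0 rstep]]] :=
  stepsize_bounds A_neq0 tau0 kappa0 nu0 theta_bound generated.
have rb k : rlo <= r k <= rhi by have [] := rstep k.
have r0 k : 0 < r k by apply: lt_le_trans rlo0 _; case/andP: (rb k).
have rhi0 : 0 < rhi by apply: lt_le_trans (r0 0%N) _; case/andP: (rb 0%N).
have ystep k := gen_ytilde generated k.
have xstep k := (rstep k).2.
have VI k := prediction_variational_ineq theta1_convex theta2_convex
  X_convex Y_convex (ystep k) (xstep k).
have Owt k : Omega X Y (wt k) by split; [have [] := xstep k|have [] := ystep k].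
have usubB (u v : 'cV[R]_(n + m)) : usubmx (u - v) = usubmx u - usubmx v.
  by apply/colP => i; rewrite !mxE.
have relaxed' k : 1 / s * sqnorm (A *m usubmx (w k - wt k)) <=
    nu * r k * sqnorm (usubmx (w k - wt k)) by rewrite usubB.
have dn0 k : w k - wt k != 0 by rewrite subr_eq0; apply/eqP.
(* C is twice the constant of sqnormH_M_DP_le and lo half the least diagonal
   weight, both because Q_DP_coercive keeps half of the diagonal terms *)
pose C := 2 * (rhi / ra + 2); pose lo := Num.min rlo s / 2.
have C0 : 0 < C by rewrite mulr_gt0// addr_gt0// divr_gt0.
have lo0 : 0 < lo by rewrite divr_gt0// lt_min rlo0.
pose phi k := dotv (w k - wt k) (Q_DP A s (r k) *m (w k - wt k)).
have phi_lo k : lo * sqnorm (w k - wt k) <= phi k.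
  apply: le_trans (Q_DP_coercive s0 (r0 k) nu1 (relaxed' k)).
  rewrite /lo mulrAC ler_pM2r ?invr_gt0// -[X in sqnorm X]vsubmxK sqnorm_col_mx.
  have [rk _] := andP (rb k).
  rewrite mulrDr lerD// ler_wpM2r ?sqnorm_ge0//.
    by rewrite ge_min rk.
  by rewrite ge_min lexx orbT.
have phi_hi k : sqnormH (H_DP s ra) (M_DP A s ra (r k) *m (w k - wt k)) <= C * phi k.
  apply: le_trans (sqnormH_M_DP_le s0 ra0 (r0 k) nu1 (relaxed' k)) _.
  have := Q_DP_coercive s0 (r0 k) nu1 (relaxed' k); rewrite -/(phi k).
  set e := _ + _ => ephi.
  have e0 : 0 <= e by rewrite addr_ge0// mulr_ge0 ?sqnorm_ge0// ltW.
  have [_ rk] := andP (rb k).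
  have : r k / ra + 2 <= rhi / ra + 2 by rewrite lerD2r ler_pM2r// invr_gt0.
  have : 0 <= rhi / ra + 2 by rewrite addr_ge0// divr_ge0// ltW.
  by rewrite /C; nra.
apply: (@fejer_cvg R (n + m) (H_DP s ra) (Num.min ra s) (gamma * (2 - gamma) / C * lo)
    _ w wt) => //.
- by rewrite lt_min ra0.
- exact: sqnormH_DP_ge.
- by rewrite mulr_gt0// divr_gt0// mulr_gt0// subr_gt0.
- move=> p Sp k; rewrite (gen_update generated) -/s -/ra addrAC.
  have coef_gt0 : 0 < gamma * (2 - gamma) / C by rewrite divr_gt0// mulr_gt0// subr_gt0.
  apply: le_trans (relaxed_step_decrease (tr_H_DP _ _) gamma_bounds C0 _ (phi_hi k) _) _.
  + exact: sqnormH_M_DP_gt0 s0 ra0 (r0 k) nu1 (relaxed' k) (dn0 k).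
  + rewrite H_DP_mul_M_DP ?gt_eqF//.
    by apply: dotv_Q_DP_solution (Owt k) Sp; exact: VI.
  + by rewrite lerD2l lerN2 -mulrA ler_pM2l.
- move=> f l wl d0.
  apply: (@limit_Omega_star R n m A theta1 theta2 X Y s rhi (r \o f) (w \o f)
    (wt \o f)) => //= k.
    by have /andP[_ ->] := rb (f k); rewrite andbT ltW.
  exact: VI.
Qed.
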